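(* Fix $r\ge 3$ and $s\ge r+1$. The only Cremona-reduced classes $c=(d;m_1,\dots,m_s)\in A^{r-1}(Y^r_s)$, with $d$ and all $m_i$ non-negative, which are Cremona-equivalent to $h-e_1$ are the classes $h-e_i$ for $1\le i\le s$. Moreover, any $(0)$-Weyl line class (i.e. any class Cremona-equivalent to $h-e_1$) with positive degree and non-negative multiplicities may be brought to $h-e_1$ via a finite series of Cremona transformations $\phi_I$, each of which strictly decreases the degree, followed by a single permutation of the indices.
   Context: $Y^r_s$ is the blowup of $\mathbb{P}^r$ at $s$ general points. Its group of curve classes $A^{r-1}(Y^r_s)$ is the free abelian group with basis $h$ (class of a general line) and $e_1,\dots,e_s$ ($e_i$ the class of a line in the $i$-th exceptional divisor). A class $c=dh-\sum_i m_ie_i$ is also written $(d;m_1,\dots,m_s)$; $d$ is its degree and the $m_i$ are its multiplicities. For $I\subset\{1,\dots,s\}$ with $|I|=r+1$, the standard Cremona transformation $\phi_I$ acts on $A^{r-1}(Y^r_s)$ by $dh-\sum m_ie_i\mapsto d'h-\sum m_i'e_i$, where with $t=d-\sum_{i\in I}m_i$ one has $d'=d+(r-1)t$, $m_i'=m_i+t$ for $i\in I$, $m_i'=m_i$ for $i\notin I$. The Weyl group is generated by all $\phi_I$ and the permutations of $e_1,\dots,e_s$. Two classes are Cremona-equivalent if they are in the same orbit of the Weyl group. A class is Cremona reduced if $d\ge\sum_{i\in I}m_i$ for every $(r+1)$-subset $I$ of the indices. *)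

(* Defs.v *)
From mathcomp Require Import all_boot all_order all_algebra all_fingroup.

Set Implicit Arguments.
Unset Strict Implicit.
Unset Printing Implicit Defensive.

Import Order.TTheory GRing.Theory Num.Theory.
Local Open Scope ring_scope.

(* The group A^{r-1}(Y^r_s), as the free abelian group on h, e_1, ..., e_s:
   a class is given by its coefficient at h and its coefficients at the e_i.
   The indices 1, ..., s are the elements of 'I_s, so e_1 is e_(ord 0). *)
Definition curve_class (s : nat) : Type := (int * {ffun 'I_s -> int})%type.

Section CurveClasses.

Variable s : nat.
Implicit Types (c : curve_class s) (i : 'I_s) (I : {set 'I_s}).

Definition line_class : curve_class s := (1, 0).

Definition exc_class i : curve_class s := (0, [ffun j => (j == i)%:R]).

Definition class_of (d : int) (m : 'I_s -> int) : curve_class s :=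
  line_class *~ d - \sum_i exc_class i *~ m i.

Definition degree c : int := c.1.

(* Multiplicities are the opposites of the coefficients at the e_i; see
   [class_ofK]. *)
Definition mult c i : int := - c.2 i.

Lemma class_ofE (d : int) (m : 'I_s -> int) :
  class_of d m = (d, [ffun i => - m i]).
Proof.
rewrite [LHS]surjective_pairing; congr (_, _).
  rewrite /class_of raddfB raddfMz raddf_sum /= big1 => [|i _].
    by rewrite subr0 intz.
  by rewrite raddfMz mul0rz.
rewrite /class_of raddfB raddfMz raddf_sum /= mul0rz sub0r.
apply/ffunP=> j; rewrite !ffunE sum_ffunE (bigD1 j) //= big1 => [|i nij].
  by rewrite raddfMz /= ffunMzE ffunE eqxx intz addr0.
by rewrite raddfMz /= ffunMzE ffunE eq_sym (negPf nij) mul0rz.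
Qed.

Lemma class_ofK c : class_of (degree c) (mult c) = c.
Proof.
rewrite class_ofE [RHS]surjective_pairing; congr (_, _).
by apply/ffunP=> i; rewrite ffunE opprK.
Qed.

Lemma degree_class_of (d : int) (m : 'I_s -> int) : degree (class_of d m) = d.
Proof. by rewrite class_ofE. Qed.

Lemma mult_class_of (d : int) (m : 'I_s -> int) i : mult (class_of d m) i = m i.
Proof. by rewrite class_ofE /mult ffunE opprK. Qed.

Definition cremona (r : nat) I c : curve_class s :=
  let t := degree c - \sum_(i in I) mult c i in
  class_of (degree c + (r%:Z - 1) * t)
           (fun i => if i \in I then mult c i + t else mult c i).

(* The automorphism fixing h and sending e_i to e_(g i). *)
Definition permute_class (g : {perm 'I_s}) c : curve_class s :=
  class_of (degree c) (fun i => mult c ((g^-1)%g i)).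

(* The Weyl group, as the set of its elements acting on classes. *)
Inductive weyl (r : nat) : (curve_class s -> curve_class s) -> Prop :=
| weyl_cremona I : #|I| = r.+1 -> weyl r (cremona r I)
| weyl_permute (g : {perm 'I_s}) : weyl r (permute_class g)
| weyl_id : weyl r id
| weyl_comp u v : weyl r u -> weyl r v -> weyl r (u \o v)
| weyl_inv u v : weyl r u -> cancel u v -> cancel v u -> weyl r v.

Definition cremona_equivalent (r : nat) c c' : Prop :=
  exists2 w, weyl r w & w c = c'.

Definition cremona_reduced (r : nat) c : Prop :=
  forall I, #|I| = r.+1 -> \sum_(i in I) mult c i <= degree c.

(* [c'] is obtained from [c] by a finite series of standard Cremona
   transformations, each strictly decreasing the degree. *)
Inductive decreasing_cremona_series (r : nat) :
  curve_class s -> curve_class s -> Prop :=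
| series_nil c : decreasing_cremona_series r c c
| series_cons I c c' :
    #|I| = r.+1 -> degree (cremona r I c) < degree c ->
    decreasing_cremona_series r (cremona r I c) c' ->
    decreasing_cremona_series r c c'.

End CurveClasses.

Arguments line_class {s}.

Definition first_index (r s : nat) (rs : (r.+1 <= s)%N) : 'I_s :=
  Ordinal (leq_ltn_trans (leq0n r) rs).

(* Main.v *)
Require Import Defs.
From HB Require Import structures.
From mathcomp Require Import all_boot all_order all_algebra all_fingroup.
From mathcomp Require Import zify ring.

Set Implicit Arguments.
Unset Strict Implicit.
Unset Printing Implicit Defensive.

Import Order.TTheory GRing.Theory Num.Theory.
Local Open Scope ring_scope.

(** The Weyl group is a Coxeter group acting on curve classes: it is generated
    by the Cremona transformation on the first r+1 indices and by the swaps of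
    two consecutive indices.  Each of these is a reflection
    c |-> c - root(c) coroot, and the pairings of roots with coroots form the
    Cartan matrix of the simply laced diagram T_(2, r+1, s-r-1).  A class is
    dominant, i.e. nonnegative on all the simple roots, when its
    multiplicities are weakly decreasing and it is Cremona reduced; h - e_1 is
    dominant.

    Consider Mozes' numbers game: a move replaces c by its reflection in a
    simple root that is negative on c.  In a simply laced system the game is
    strongly confluent: if some play of length n leads from c to a dominant
    c0, then any legal first move from c can be completed to a play of length
    n leading to c0 ([plays_to_confluent]).  Hence the set of classes from
    which some play leads to c0 is stable under all simple reflections
    ([plays_to_reflection]), so it contains the Weyl orbit of c0.

    Applied to c0 = h - e_1 this gives the two facts that make up the theorem.
    A legal move never increases the degree, because the Cremona move at a
    class with d < sum m_i subtracts (r-1)(sum m_i - d) and the swaps do not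
    change d; hence every class in the orbit has degree at least
    deg(h - e_1) = 1 ([in_line_orbit_degree]).  And a Cremona reduced class
    admits no Cremona move, nor do its permutations, so the play that joins it
    to h - e_1 consists of swaps only and the class is some h - e_i
    ([reduced_in_line_orbit]).  Finally, as long as a class in the orbit is
    not reduced, some Cremona transformation strictly decreases its degree;
    since degrees stay positive this process stops, and it can only stop at a
    reduced class, that is, at some h - e_i, which a transposition takes to
    h - e_1. *)

(** * The numbers game in a simply laced root system *)

Section NumbersGame.

Variables (V : zmodType) (K : eqType).
Variables (root : K -> {additive V -> int}) (coroot : K -> V).
Implicit Types (c : V) (i j k : K).

Definition reflection k c : V := c - coroot k *~ root k c.

(** Existence of a play of exactly [n] moves, each using a root that is
    negative on the current vector.  The length is recorded because
    confluence is proved by induction on it. *)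
Fixpoint plays_to (c0 : V) (n : nat) (c : V) : Prop :=
  if n is n'.+1 then
    exists2 k, root k c < 0 & plays_to c0 n' (reflection k c)
  else c = c0.

Hypothesis root_coroot : forall k, root k (coroot k) = 2.

Hypothesis simply_laced : forall i j, i != j ->
  root i (coroot j) = root j (coroot i) /\
  (root i (coroot j) = 0 \/ root i (coroot j) = -1).

Lemma root_reflection i k c :
  root i (reflection k c) = root i c - root i (coroot k) * root k c.
Proof. by rewrite /reflection raddfB raddfMz -mulrzr intz. Qed.

Lemma root_reflection_same k c : root k (reflection k c) = - root k c.
Proof. by rewrite root_reflection root_coroot; ring. Qed.

Lemma reflection_fixed k c : root k c = 0 -> reflection k c = c.
Proof. by rewrite /reflection => ->; rewrite mulr0z subr0. Qed.

Lemma reflectionK k : involutive (reflection k).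
Proof.
move=> c; rewrite {1}/reflection root_reflection_same mulrNz opprK.
by rewrite /reflection subrK.
Qed.

Lemma reflection_commute i j c :
  root i (coroot j) = 0 -> root j (coroot i) = 0 ->
  reflection i (reflection j c) = reflection j (reflection i c).
Proof.
move=> aij aji; rewrite [LHS]/reflection [RHS]/reflection.
by rewrite !root_reflection aij aji !mul0r !subr0 /reflection addrAC.
Qed.

(** Both sides subtract the third positive root of the A_2 system spanned by
    i and j: they are the reflection with root [root i + root j] and coroot
    [coroot i + coroot j]. *)
Lemma reflection_braid i j c :
  root i (coroot j) = -1 -> root j (coroot i) = -1 ->
  reflection i (reflection j (reflection i c)) =
  reflection j (reflection i (reflection j c)).
Proof.
have step x y : root x (coroot y) = -1 -> root y (coroot x) = -1 ->
    reflection x (reflection y (reflection x c)) =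
    c - (coroot x + coroot y) *~ (root x c + root y c).
  move=> axy ayx; rewrite [LHS]/reflection.
  rewrite !root_reflection root_coroot axy ayx.
  rewrite /reflection root_reflection ayx.
  rewrite -!addrA; congr (_ + _).
  rewrite -!opprD; congr (- _).
  rewrite addrCA -mulrzDr mulrzDl [RHS]addrC; congr (_ *~ _ + _ *~ _); ring.
move=> aij aji; rewrite (step i j) // (step j i) //.
by rewrite (addrC (coroot j)) (addrC (root j c)).
Qed.

Section Play.

Variable c0 : V.
Hypothesis c0_dominant : forall k, 0 <= root k c0.

(** Let j be the first move of the given play and i another legal move.  The
    two moves generate a dihedral group of order 4 or 6 in which both roots
    are negative at c, so the two alternating words of length 2 or 3 from c to
    the common end point are both legal.  By induction the play through j may
    be assumed to follow the word beginning with j; the word beginning with i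
    has the same length and the same end point.  Dominance of c0 excludes the
    cases in which the play would already be over inside the word. *)
Lemma plays_to_confluent n c k :
  plays_to c0 n.+1 c -> root k c < 0 -> plays_to c0 n (reflection k c).
Proof.
elim/ltn_ind: n c k => n IHn c i [j cj playj] ci.
have [-> //|nij] := eqVneq i j.
have [sym [aij|aij]] := simply_laced nij.
(* Commuting reflections: replace the play j, i, ... by i, j, ... *)
- have aji := sym; rewrite aij in aji.
  have ij : root i (reflection j c) < 0.
    by rewrite root_reflection aij mul0r subr0.
  case: n IHn playj => [|n] IHn playj.
    by move: ij (c0_dominant i); rewrite playj ltNge => /negPf ->.
  have {IHn} play2 := IHn n (ltnSn n) _ _ playj ij.
  exists j; last by rewrite reflection_commute.
  by rewrite root_reflection -aji mul0r subr0.
(* Braid relation: replace the play j, i, j, ... by i, j, i, ... *)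
- have aji := sym; rewrite aij in aji.
  have ij : root i (reflection j c) = root i c + root j c.
    by rewrite root_reflection aij; ring.
  have ji : root j (reflection i c) = root i c + root j c.
    by rewrite root_reflection -aji; ring.
  have ij_lt0 : root i (reflection j c) < 0 by rewrite ij; lia.
  case: n IHn playj => [|n] IHn playj.
    by move: ij_lt0 (c0_dominant i); rewrite playj ltNge => /negPf ->.
  have play2 := IHn n (ltnSn n) _ _ playj ij_lt0.
  have jij : root j (reflection i (reflection j c)) < 0.
    rewrite root_reflection -aji ij root_reflection_same; lia.
  case: n IHn playj play2 => [|n] IHn playj play2.
    by move: jij (c0_dominant j); rewrite play2 ltNge => /negPf ->.
  have play3 := IHn n (leqW (ltnSn n)) _ _ play2 jij.
  exists j; first by rewrite ji; lia.
  exists i; last by rewrite reflection_braid.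
  by rewrite root_reflection aij ji root_reflection_same; lia.
Qed.

(** A legal reflection shortens the play by confluence; if the root is
    positive, it is legal to reflect back, which lengthens the play by one
    move. *)
Lemma plays_to_reflection k c :
  (exists n, plays_to c0 n c) -> exists n, plays_to c0 n (reflection k c).
Proof.
move=> [n play]; case: (ltgtP (root k c) 0) => [ck|ck|ck].
- case: n play => [ec|n play]; last by exists n; apply: plays_to_confluent.
  by move: ck (c0_dominant k); rewrite ec ltNge => /negPf ->.
- exists n.+1, k; last by rewrite reflectionK.
  by rewrite root_reflection_same oppr_lt0.
- by exists n; rewrite reflection_fixed.
Qed.

End Play.

End NumbersGame.

(** * Permutations, Cremona transformations and the classes h - e_i *)

Section PermuteClass.

Variable s : nat.
Implicit Types (c : curve_class s) (g : {perm 'I_s}).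

Lemma curve_class_eqP c c' :
  degree c = degree c' -> mult c =1 mult c' -> c = c'.
Proof.
move=> dc mc; rewrite -[c]class_ofK -[c']class_ofK dc !class_ofE.
by congr (_, _); apply/ffunP=> i; rewrite !ffunE mc.
Qed.

Lemma degree_permute g c : degree (permute_class g c) = degree c.
Proof. exact: degree_class_of. Qed.

Lemma mult_permute g c i : mult (permute_class g c) i = mult c (g^-1%g i).
Proof. exact: mult_class_of. Qed.

Lemma permute_classM g h c :
  permute_class (g * h)%g c = permute_class h (permute_class g c).
Proof.
apply: curve_class_eqP => [|i]; rewrite ?degree_permute // !mult_permute.
by rewrite invMg permM.
Qed.

Lemma permute_class1 c : permute_class 1 c = c.
Proof.
apply: curve_class_eqP => [|i]; rewrite ?degree_permute // mult_permute.
by rewrite invg1 perm1.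
Qed.

Lemma permute_classK g : cancel (permute_class g) (permute_class g^-1).
Proof. by move=> c; rewrite -permute_classM mulgV permute_class1. Qed.

(** Permutations conjugate Cremona transformations into one another; this
    reduces all of them to the one on the first r+1 indices. *)
Lemma cremona_permute r g (I : {set 'I_s}) c :
  cremona r (g @: I) (permute_class g c) = permute_class g (cremona r I c).
Proof.
have sumE : \sum_(i in g @: I) mult (permute_class g c) i
            = \sum_(i in I) mult c i.
  rewrite big_imset /=; last by move=> x y _ _; apply: perm_inj.
  by apply: eq_bigr => i _; rewrite mult_permute permK.
rewrite /cremona degree_permute sumE.
apply: curve_class_eqP => [|i]; first by rewrite degree_permute !degree_class_of.
rewrite mult_permute !mult_class_of.
by rewrite -{1}[i](permKV g) mem_imset //; apply: perm_inj.
Qed.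

Lemma cremona_reduced_permute r g c :
  cremona_reduced r c -> cremona_reduced r (permute_class g c).
Proof.
move=> red I cardI; rewrite degree_permute.
have := red (g^-1%g @: I); rewrite card_imset //; last exact: perm_inj.
move=> /(_ cardI); rewrite big_imset /=; last by move=> x y _ _; apply: perm_inj.
by under eq_bigr do rewrite -mult_permute.
Qed.

Lemma cremonaK r (I : {set 'I_s}) : #|I| = r.+1 -> involutive (cremona r I).
Proof.
move=> cardI c; set t := degree c - \sum_(i in I) mult c i.
have tE : degree (cremona r I c) - \sum_(i in I) mult (cremona r I c) i = - t.
  rewrite degree_class_of -/t.
  have -> : \sum_(i in I) mult (cremona r I c) i = \sum_(i in I) (mult c i + t).
    by apply: eq_bigr => i iI; rewrite mult_class_of iI.
  rewrite big_split /= sumr_const cardI -/t.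
  have -> : \sum_(i in I) mult c i = degree c - t by rewrite /t; ring.
  by rewrite -mulr_natr; lia.
rewrite {1}/cremona tE; apply: curve_class_eqP => [|i].
  by rewrite !degree_class_of -/t; ring.
by rewrite !mult_class_of -/t; case: (i \in I); rewrite ?addrK.
Qed.

Definition line_through i : curve_class s := line_class - exc_class i.

Lemma line_throughE i :
  line_through i = class_of 1 (fun j => (j == i)%:R).
Proof.
rewrite class_ofE /line_through; congr (_, _).
by apply/ffunP=> j; rewrite !ffunE sub0r.
Qed.

Lemma degree_line_through i : degree (line_through i) = 1.
Proof. by rewrite line_throughE degree_class_of. Qed.

Lemma mult_line_through i j : mult (line_through i) j = (j == i)%:R.
Proof. by rewrite line_throughE mult_class_of. Qed.

Lemma permute_line_through g i :
  permute_class g (line_through i) = line_through (g i).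
Proof.
apply: curve_class_eqP => [|j].
  by rewrite degree_permute !degree_line_through.
by rewrite mult_permute !mult_line_through -{2}[j](permKV g) (inj_eq perm_inj).
Qed.

Lemma line_through_reduced r i : cremona_reduced r (line_through i).
Proof.
move=> I _; rewrite degree_line_through.
under eq_bigr do rewrite mult_line_through.
have [iI|/negP iI] := boolP (i \in I).
  by rewrite (bigD1 i) //= eqxx big1 ?addr0 // => j /andP[_ /negPf ->].
by rewrite big1 // => j jI; case: eqP => // ji; case: iI; rewrite -ji.
Qed.

End PermuteClass.

(** * The simple roots of the Weyl group *)

Section CremonaRoots.

Variables (r s : nat).
Hypothesis r_gt0 : (0 < r)%N.
Hypothesis s_ge : (r.+1 <= s)%N.
Implicit Types (c : curve_class s) (k : 'I_s).

Definition first_indices : {set 'I_s} := [set i : 'I_s | (i < r.+1)%N].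

Lemma card_first_indices : #|first_indices| = r.+1.
Proof.
have -> : first_indices = widen_ord s_ge @: [set: 'I_r.+1].
  apply/setP=> i; rewrite inE; apply/idP/imsetP => [ir|[j _ ->]] //=.
  by exists (Ordinal ir); [rewrite inE | apply: val_inj].
by rewrite card_imset ?cardsT ?card_ord // => i j [ij]; apply: val_inj.
Qed.

(** The permutation lists the elements of I first, then the others. *)
Lemma first_indices_transitive (I : {set 'I_s}) :
  #|I| = r.+1 -> exists g : {perm 'I_s}, g @: first_indices = I.
Proof.
move=> cardI; pose t := enum I ++ enum (~: I).
have perm_t : perm_eq t (ord_tuple s).
  apply: uniq_perm; rewrite ?val_ord_tuple ?enum_uniq //.
    rewrite cat_uniq !enum_uniq andbT /=; apply/hasPn=> x.
    by rewrite !mem_enum inE.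
  by move=> x; rewrite mem_cat !mem_enum !inE orbN.
have /tuple_permP[g tE] := perm_t; exists g.
apply/eqP; rewrite eqEcard card_imset ?card_first_indices ?cardI ?leqnn ?andbT;
  last exact: perm_inj.
apply/subsetP=> _ /imsetP[i + ->]; rewrite inE => ir.
have -> : g i = nth i t i.
  rewrite tE -tnth_nth.
  by rewrite tnth_mktuple tnth_ord_tuple.
by rewrite nth_cat -cardE cardI ir -mem_enum mem_nth // -cardE cardI.
Qed.

(** Index 0 stands for the Cremona transformation on the first r+1 indices, and
    an index k > 0 for the swap of k - 1 and k; on such k, [ord_pred] is the
    true predecessor and does not wrap around. *)
Definition simple_root k c : int :=
  if k == 0 :> nat then degree c - \sum_(i in first_indices) mult c i
  else mult c (ord_pred k) - mult c k.

Definition simple_coroot k : curve_class s :=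
  if k == 0 :> nat
  then class_of (1 - r%:Z) (fun i => - (i \in first_indices)%:R)
  else class_of 0 (fun i => (i == ord_pred k)%:R - (i == k)%:R).

Lemma multB c c' i : mult (c - c') i = mult c i - mult c' i.
Proof. by rewrite /mult !ffunE /= opprD. Qed.

Lemma simple_root_additive k : zmod_morphism (simple_root k).
Proof.
move=> c c'; rewrite /simple_root; case: ifP => _; last by rewrite !multB; ring.
under eq_bigr do rewrite multB.
by rewrite sumrB /degree /=; ring.
Qed.

HB.instance Definition _ k :=
  GRing.isZmodMorphism.Build (curve_class s) int (simple_root k)
    (simple_root_additive k).

Lemma val_ord_pred k : (0 < k)%N -> ord_pred k = k.-1 :> nat.
Proof.
move=> k0 /=; rewrite -[X in (X + s)%N](prednK k0) addSn /= modnDr modn_small //.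
by apply: leq_ltn_trans (leq_pred _) _.
Qed.

Lemma simple_root_coroot_eq k : simple_root k (simple_coroot k) = 2.
Proof.
rewrite /simple_root /simple_coroot; case k0: (k == 0 :> nat).
  rewrite degree_class_of.
  under eq_bigr => i iI do rewrite mult_class_of iI.
  rewrite sumr_const card_first_indices -mulNrn; lia.
have kp : (ord_pred k == k) = false.
  by apply/eqP=> /(congr1 (@nat_of_ord s)); rewrite val_ord_pred; lia.
by rewrite !mult_class_of !eqxx kp eq_sym kp.
Qed.


(** The swaps form a chain of type A, and the Cremona node is joined only to the
    swap of r and r+1, the one that moves the set of the first r+1 indices. *)
Lemma simple_roots_simply_laced i j : i != j ->
  simple_root i (simple_coroot j) = simple_root j (simple_coroot i) /\
  (simple_root i (simple_coroot j) = 0 \/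
   simple_root i (simple_coroot j) = -1).
Proof.
have cremona_swap (k : 'I_s) : (0 < k)%N ->
    - \sum_(i in first_indices) ((i == ord_pred k)%:R - (i == k)%:R) =
    - (ord_pred k \in first_indices)%:R + (k \in first_indices)%:R :> int.
  have sum1 (l : 'I_s) :
      \sum_(i in first_indices) (i == l)%:R = (l \in first_indices)%:R :> int.
    rewrite big_mkcond /= (bigD1 l) //= eqxx big1 ?addr0 => [|m /negPf ->].
      by case: ifP.
    by case: ifP.
  by move=> k0; rewrite sumrB !sum1; ring.
rewrite /simple_root /simple_coroot => nij.
have [i0|i0] := posnP i; have [j0|j0] := posnP j.
- by case/eqP: nij; apply: val_inj; rewrite /= i0 j0.
- rewrite degree_class_of !mult_class_of add0r.
  under eq_bigr do rewrite mult_class_of.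
  rewrite cremona_swap // !inE val_ord_pred //.
  split; first by ring.
  by lia.
- rewrite degree_class_of !mult_class_of add0r.
  under eq_bigr do rewrite mult_class_of.
  rewrite cremona_swap // !inE val_ord_pred //.
  split; first by ring.
  by lia.
- rewrite !mult_class_of -!(inj_eq (@ord_inj s)).
  have := nij; rewrite -(inj_eq (@ord_inj s)) !val_ord_pred //.
  by move=> nij'; split; lia.
Qed.


Lemma degreeB_mulz c c' n : degree (c - c' *~ n) = degree c - degree c' * n.
Proof. by rewrite /degree raddfB raddfMz /= -mulrzr intz. Qed.

Lemma multB_mulz c c' n i : mult (c - c' *~ n) i = mult c i - mult c' i * n.
Proof.
by rewrite multB /mult [(_ *~ _).2]raddfMz ffunMzE mulNr -mulrzr intz.
Qed.

Lemma reflection_cremona k c : k = 0%N :> nat ->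
  reflection simple_root simple_coroot k c = cremona r first_indices c.
Proof.
move=> k0; apply: curve_class_eqP => [|i].
  rewrite degreeB_mulz degree_class_of /= /simple_root /simple_coroot k0 eqxx.
  by rewrite degree_class_of; ring.
rewrite multB_mulz mult_class_of /= /simple_root /simple_coroot k0 eqxx.
by rewrite mult_class_of; case: ifP => _ /=; ring.
Qed.

Lemma reflection_permute k c : (0 < k)%N ->
  reflection simple_root simple_coroot k c =
  permute_class (tperm (ord_pred k) k) c.
Proof.
move=> k0; apply: curve_class_eqP => [|i].
  rewrite degreeB_mulz degree_permute /simple_coroot (gtn_eqF k0).
  by rewrite degree_class_of; ring.
rewrite multB_mulz mult_permute /= /simple_root /simple_coroot (gtn_eqF k0).
have kp : (k == ord_pred k) = false.
  by apply/eqP=> /(congr1 (@nat_of_ord s)); rewrite val_ord_pred; lia.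
rewrite mult_class_of tpermV; case: tpermP => [->|->|/eqP/negPf-> /eqP/negPf->].
- by rewrite eqxx eq_sym kp /=; ring.
- by rewrite eqxx kp /=; ring.
- by rewrite /=; ring.
Qed.

(** * Sets stable under simple reflections are stable under the Weyl group *)

Section Orbit.

Variable P : curve_class s -> Prop.
Hypothesis P_reflection : forall k c,
  P c -> P (reflection simple_root simple_coroot k c).

(** Consecutive swaps generate the symmetric group: by induction on y,
    (x y) is the conjugate of (x y-1) by (y-1 y). *)
Lemma orbit_permute g c : P c -> P (permute_class g c).
Proof.
have adjacent (x y : 'I_s) : (x < y)%N ->
    forall c, P c -> P (permute_class (tperm x y) c).
  have [n] := ubnP y; elim: n x y => // n IHn x y yn xy {}c Pc.
  have y0 : (0 < y)%N by apply: leq_ltn_trans xy.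
  have Padj c' : P c' -> P (permute_class (tperm (ord_pred y) y) c').
    by rewrite -reflection_permute //; apply: P_reflection.
  have [->|nxy] := eqVneq x (ord_pred y); first exact: Padj.
  have xpy : (x < ord_pred y)%N.
    by move: nxy; rewrite -(inj_eq (@ord_inj s)) val_ord_pred //; lia.
  have -> : tperm x y = (tperm x (ord_pred y) ^ tperm (ord_pred y) y)%g.
    rewrite tpermJ tpermL tpermD // ; first by rewrite eq_sym.
    by rewrite -(inj_eq (@ord_inj s)); lia.
  rewrite /conjg tpermV !permute_classM.
  by apply/Padj/IHn/Padj => //; rewrite val_ord_pred //; lia.
have [ts -> _] := prod_tpermP g.
elim: ts c => [|[x y] ts IHts] c Pc.
  by rewrite big_nil permute_class1.
rewrite big_cons permute_classM /=; apply: IHts.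
have [xy|yx|/ord_inj ->] := ltngtP x y; first exact: adjacent.
  by rewrite tpermC; apply: adjacent.
by rewrite tperm1 permute_class1.
Qed.

Lemma orbit_cremona (I : {set 'I_s}) c : #|I| = r.+1 -> P c -> P (cremona r I c).
Proof.
move=> cardI Pc; have [g <-] := first_indices_transitive cardI.
rewrite -[c](permute_classK g^-1) invgK cremona_permute; apply: orbit_permute.
pose k := first_index s_ge.
by rewrite -(@reflection_cremona k) //; apply/P_reflection/orbit_permute.
Qed.

End Orbit.

(** * The orbit of h - e_1 *)

Lemma line_through_dominant k :
  0 <= simple_root k (line_through (first_index s_ge)).
Proof.
rewrite /simple_root; case: ifP => [_|/negbT k0].
  rewrite subr_ge0; apply: line_through_reduced; exact: card_first_indices.
rewrite !mult_line_through -!(inj_eq (@ord_inj s)) (negPf k0) subr0.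
by case: eqP.
Qed.

(** The Weyl orbit of h - e_1, described through the numbers game rather than
    through group elements, so that it comes with a play to induct on. *)
Definition in_line_orbit c :=
  exists n, plays_to simple_root simple_coroot
              (line_through (first_index s_ge)) n c.

Lemma in_line_orbit_reflection k c :
  in_line_orbit c -> in_line_orbit (reflection simple_root simple_coroot k c).
Proof.
apply: plays_to_reflection; first exact: simple_root_coroot_eq.
  exact: simple_roots_simply_laced.
exact: line_through_dominant.
Qed.

(** The equivalence, rather than one implication, is what passes to inverses in
    the Weyl group. *)
Lemma in_line_orbit_weyl w c : weyl r w -> in_line_orbit (w c) <-> in_line_orbit c.
Proof.
have iff_of (u v : curve_class s -> curve_class s) : cancel u v ->
    (forall c, in_line_orbit c -> in_line_orbit (u c)) ->
    (forall c, in_line_orbit c -> in_line_orbit (v c)) ->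
    forall c, in_line_orbit (u c) <-> in_line_orbit c.
  by move=> uK Pu Pv c'; split=> [/Pv|/Pu //]; rewrite uK.
move=> Ww; elim: Ww c => {w} [I cardI|g||u v _ IHu _ IHv|u v _ IHu uK vK] c.
- apply: iff_of; first exact: cremonaK.
    by move=> c'; apply: orbit_cremona => //; apply: in_line_orbit_reflection.
  by move=> c'; apply: orbit_cremona => //; apply: in_line_orbit_reflection.
- apply: iff_of; first exact: permute_classK.
    by move=> c'; apply: orbit_permute; apply: in_line_orbit_reflection.
  by move=> c'; apply: orbit_permute; apply: in_line_orbit_reflection.
- by [].
- by rewrite /= IHu IHv.
- by rewrite -IHu vK.
Qed.

Lemma equivalent_in_line_orbit c :
  cremona_equivalent r c (line_through (first_index s_ge)) -> in_line_orbit c.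
Proof.
by move=> [w Ww wc]; rewrite -(in_line_orbit_weyl _ Ww) wc; exists 0%N.
Qed.

(** Legal moves do not increase the degree, and they end at degree 1. *)
Lemma in_line_orbit_degree c : in_line_orbit c -> 1 <= degree c.
Proof.
case=> n; elim: n c => [c ->|n IHn c [k ck /IHn]].
  by rewrite degree_line_through.
have [k0|k0] := posnP k; last by rewrite reflection_permute ?degree_permute.
rewrite degreeB_mulz; move: ck.
rewrite /= /simple_root /simple_coroot k0 eqxx degree_class_of; nia.
Qed.

(** A play from a reduced class never makes a Cremona move: swaps preserve
    reducedness, so it ends with h - e_1 by permuting the indices only. *)
Lemma reduced_in_line_orbit c :
  in_line_orbit c -> cremona_reduced r c -> exists i, c = line_through i.
Proof.
case=> n; elim: n c => [c -> _|n IHn c [k ck play] red].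
  by exists (first_index s_ge).
have [k0|k0] := posnP k.
  move: ck; rewrite /= /simple_root k0 eqxx subr_lt0 ltNge red //.
  exact: card_first_indices.
move: play; rewrite reflection_permute // => play.
have [i ci] := IHn _ play (cremona_reduced_permute _ red).
exists ((tperm (ord_pred k) k)^-1%g i).
by rewrite -permute_line_through -ci permute_classK.
Qed.

End CremonaRoots.

Theorem theorem5p9 (r s : nat) (r_ge3 : (3 <= r)%N) (s_ge : (r.+1 <= s)%N) :
  let l1 : curve_class s := line_class - exc_class (first_index s_ge) in
  (forall c : curve_class s,
     [/\ 0 <= degree c, forall i : 'I_s, 0 <= mult c i,
         cremona_reduced r c & cremona_equivalent r c l1]
     <-> exists i : 'I_s, c = line_class - exc_class i)
  /\
  (forall c : curve_class s,
     cremona_equivalent r c l1 ->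
     0 < degree c ->
     (forall i : 'I_s, 0 <= mult c i) ->
     exists (c' : curve_class s) (g : {perm 'I_s}),
       decreasing_cremona_series r c c' /\ permute_class g c' = l1).
Proof.
have r_gt0 : (0 < r)%N by apply: leq_trans r_ge3.
set o := first_index s_ge => l1.
have to_l1 i : permute_class (tperm i o) (line_through i) = l1.
  by rewrite permute_line_through tpermL.
split=> [c|c /(equivalent_in_line_orbit r_gt0) orb_c _ _].
  split=> [[_ _ red /(equivalent_in_line_orbit r_gt0) orb_c]|[i ->]].
    exact: reduced_in_line_orbit orb_c red.
  rewrite -/(line_through i); split.
  - by rewrite degree_line_through.
  - by move=> j; rewrite mult_line_through; case: eqP.
  - exact: line_through_reduced.
  - by exists (permute_class (tperm i o)); [apply: weyl_permute | apply: to_l1].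
(* Degrees in the orbit are positive, so their absolute values strictly
   decrease along the series and serve as a termination measure. *)
have [n] := ubnP `|degree c|%N; elim: n c orb_c => // n IHn c orb_c deg_c.
have [/existsP[I /andP[/eqP cardI]]|noI] := boolP
  [exists I : {set 'I_s}, (#|I| == r.+1) && (degree c < \sum_(i in I) mult c i)].
  rewrite -subr_lt0 => t_lt0.
  have orb_I : in_line_orbit s_ge (cremona r I c).
    by apply: orbit_cremona => // k c'; apply: in_line_orbit_reflection.
  have deg_lt : degree (cremona r I c) < degree c.
    by rewrite degree_class_of; nia.
  have := in_line_orbit_degree r_gt0 orb_I => deg_ge1.
  have [|c' [g [ser gc']]] := IHn _ orb_I; first by lia.
  by exists c', g; split=> //; apply: series_cons ser.
have [|i ->] := reduced_in_line_orbit r_gt0 orb_c.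
  move=> I cardI; rewrite leNgt; apply: contra noI => lt_I.
  by apply/existsP; exists I; rewrite cardI eqxx.
by exists (line_through i), (tperm i o); split; [apply: series_nil | apply: to_l1].
Qed.
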